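(* Let $\Phi=(A;\{E_i\}_{i=0}^d;A^*;\{E^*_i\}_{i=0}^d)$ be a tridiagonal system on $V$ with $d\ge1$, eigenvalue sequence $\{\theta_i\}_{i=0}^d$ and dual eigenvalue sequence $\{\theta^*_i\}_{i=0}^d$. Let $L$ be the $\Phi$-lowering map, let $\mathcal R,\mathcal L$ be the $\Phi$-split raising and lowering maps, let $\{F_i\}_{i=0}^d$ be the projections for the $\Phi$-split decomposition, and put $T=\sum_{\ell=0}^dF_\ell E^*_\ell$. Define maps $H_j$ $(1\le j\le d)$ as follows. For $2\le j\le d-1$, $$H_j=\frac{\theta_j-\theta_{j-1}}{\theta^*_{j-1}-\theta^*_j}\mathcal L+\frac{\mathcal R\mathcal L^2}{(\theta^*_j-\theta^*_{j-1})(\theta^*_j-\theta^*_{j-2})}-\frac{\mathcal L\mathcal R\mathcal L}{(\theta^*_{j-1}-\theta^*_j)^2}+\frac{\mathcal L^2\mathcal R}{(\theta^*_{j-1}-\theta^*_j)(\theta^*_{j-1}-\theta^*_{j+1})}.$$ If $d\ge2$, $$H_1=\frac{\theta_1-\theta_0}{\theta^*_0-\theta^*_1}\mathcal L-\frac{\mathcal L\mathcal R\mathcal L}{(\theta^*_0-\theta^*_1)^2}+\frac{\mathcal L^2\mathcal R}{(\theta^*_0-\theta^*_1)(\theta^*_0-\theta^*_2)},$$ $$H_d=\frac{\theta_d-\theta_{d-1}}{\theta^*_{d-1}-\theta^*_d}\mathcal L+\frac{\mathcal R\mathcal L^2}{(\theta^*_d-\theta^*_{d-1})(\theta^*_d-\theta^*_{d-2})}-\frac{\mathcal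 L\mathcal R\mathcal L}{(\theta^*_{d-1}-\theta^*_d)^2}.$$ If $d=1$, $$H_1=\frac{\theta_1-\theta_0}{\theta^*_0-\theta^*_1}\mathcal L-\frac{\mathcal L\mathcal R\mathcal L}{(\theta^*_0-\theta^*_1)^2}.$$ Then for $1\le j\le d$ the diagram with top map $L:E^*_jV\to E^*_{j-1}V$, bottom map $H_j:F_jV\to F_{j-1}V$, and vertical maps $T:E^*_jV\to F_jV$ and $T:E^*_{j-1}V\to F_{j-1}V$ commutes; that is, $TLv=H_jTv$ for all $v\in E^*_jV$.
   Context: Let $\mathbb F$ be a field and $V$ a nonzero finite-dimensional vector space over $\mathbb F$; $\mathrm{End}(V)$ is the algebra of $\mathbb F$-linear maps $V\to V$, with identity $I$. A tridiagonal pair on $V$ is an ordered pair $A,A^*\in\mathrm{End}(V)$ such that: (1) each of $A,A^*$ is diagonalizable; (2) there is an ordering $\{V_i\}_{i=0}^d$ of the eigenspaces of $A$ with $A^*V_i\subseteq V_{i-1}+V_i+V_{i+1}$ $(0\le i\le d)$, where $V_{-1}=V_{d+1}=0$; (3) there is an ordering $\{V^*_i\}_{i=0}^\delta$ of the eigenspaces of $A^*$ with $AV^*_i\subseteq V^*_{i-1}+V^*_i+V^*_{i+1}$ $(0\le i\le\delta)$, where $V^*_{-1}=V^*_{\delta+1}=0$; (4) there is no subspace $W\subseteq V$ with $W\ne0$, $W\ne V$, $AW\subseteq W$, $A^*W\subseteq W$. It is known that $d=\delta$. Orderings as in (2), (3) are called standard. For a diagonalizable map, the primitive idempotent attached to an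 eigenspace is the projection onto that eigenspace that vanishes on the other eigenspaces; an ordering of primitive idempotents is standard if the corresponding ordering of eigenspaces is. A tridiagonal system on $V$ is a sequence $\Phi=(A;\{E_i\}_{i=0}^d;A^*;\{E^*_i\}_{i=0}^d)$ where $A,A^*$ is a tridiagonal pair on $V$, $\{E_i\}$ is a standard ordering of the primitive idempotents of $A$, and $\{E^*_i\}$ is a standard ordering of the primitive idempotents of $A^*$. Let $\theta_i$ (resp. $\theta^*_i$) be the eigenvalue of $A$ (resp. $A^*$) for $E_i$ (resp. $E^*_i$); $\{\theta_i\}_{i=0}^d$ and $\{\theta^*_i\}_{i=0}^d$ are the eigenvalue and dual eigenvalue sequences. Throughout $d\ge1$. Define $R=\sum_{i=0}^{d-1}E^*_{i+1}AE^*_i$, $F=\sum_{i=0}^dE^*_iAE^*_i$, $L=\sum_{i=1}^dE^*_{i-1}AE^*_i$ (the $\Phi$-raising, $\Phi$-flat, $\Phi$-lowering maps). $\Phi$-split decomposition: $U_i=(E^*_0V+\cdots+E^*_iV)\cap(E_iV+\cdots+E_dV)$ for $0\le i\le d$; it is known that $V=\sum_{i=0}^dU_i$ is a direct sum. $F_i\in\mathrm{End}(V)$ is the projection onto $U_i$ with $F_iU_j=0$ for $j\ne i$ (so $F_iV=U_i$). Define $\mathcal R=A-\sum_{i=0}^d\theta_iF_i$ (the $\Phi$-split raising map) and $\mathcal L=A^*-\sum_{i=0}^d\theta^*_iF_i$ (the $\Phi$-split lowering map). It is known that $\mathcal RF_iV\subseteq F_{i+1}V$, $\mathcal LF_iV\subseteq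 F_{i-1}V$ (with $F_{-1}V=F_{d+1}V=0$), and that $\sum_{\ell=0}^dF_\ell E^*_\ell$ is a bijection $V\to V$ sending $E^*_iV$ onto $F_iV$ for each $i$. *)

(* Defs.v *)
From mathcomp Require Import all_boot all_order all_algebra.

Set Implicit Arguments.
Unset Strict Implicit.
Unset Printing Implicit Defensive.

Import GRing.Theory passmx.
Local Open Scope ring_scope.

(* A sequence x_0, ..., x_d is a function on nat of which only the values at
   indices i <= d are meaningful; every definition below reads only those. *)

Section TridiagonalSystems.
Variables (K : fieldType) (V : vectType K).
Implicit Types (A B X Y : 'End(V)) (d : nat).

Definition lfun_diagonalizable A : Prop :=
  exists s : seq K, (\sum_(a <- s) leigenspace A a)%VS = fullv.

Definition eigenspace_ordering A d (W : nat -> {vspace V}) : Prop :=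
  (forall i j, (i <= d)%N -> (j <= d)%N -> W i = W j -> i = j)
  /\ (forall U : {vspace V},
        (exists2 i, (i <= d)%N & W i = U)
        <-> (exists2 a, leigenvalue A a & U = leigenspace A a)).

(* W_(i-1) + W_i + W_(i+1), where W_(-1) = W_(d+1) = 0 *)
Definition neighbour_sum d (W : nat -> {vspace V}) (i : nat) : {vspace V} :=
  ((if (0 < i)%N then W i.-1 else 0) + W i
   + (if (i < d)%N then W i.+1 else 0))%VS.

Definition standard_eigenspaces A B d (W : nat -> {vspace V}) : Prop :=
  eigenspace_ordering A d W
  /\ (forall i, (i <= d)%N -> (B @: W i <= neighbour_sum d W i)%VS).

Definition tridiagonal_pair A B : Prop :=
  [/\ lfun_diagonalizable A /\ lfun_diagonalizable B,
      exists d W, standard_eigenspaces A B d W,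
      exists d W, standard_eigenspaces B A d W
    & ~ exists W : {vspace V},
        [/\ W != 0%VS, W != fullv, (A @: W <= W)%VS & (B @: W <= W)%VS]].

Definition projection_onto X (U : {vspace V}) : Prop :=
  limg X = U /\ (forall v, v \in U -> X v = v).

Definition primitive_idempotent A (U : {vspace V}) X : Prop :=
  projection_onto X U
  /\ (forall a, leigenvalue A a -> leigenspace A a != U ->
        forall v, v \in leigenspace A a -> X v = 0).

Definition standard_idempotents A B d (E : nat -> 'End(V)) : Prop :=
  standard_eigenspaces A B d (fun i => limg (E i))
  /\ (forall i, (i <= d)%N -> primitive_idempotent A (limg (E i)) (E i)).

Definition tridiagonal_system A d (E : nat -> 'End(V)) B (Es : nat -> 'End(V))
    : Prop :=
  [/\ tridiagonal_pair A B, standard_idempotents A B d E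
    & standard_idempotents B A d Es].

Definition eigenvalue_sequence A d (E : nat -> 'End(V)) (theta : nat -> K)
    : Prop :=
  forall i, (i <= d)%N ->
    leigenvalue A (theta i) /\ limg (E i) = leigenspace A (theta i).

Definition lowering_map A d (Es : nat -> 'End(V)) : 'End(V) :=
  \sum_(1 <= i < d.+1) (Es i.-1 \o A \o Es i)%VF.

Definition split_space d (E Es : nat -> 'End(V)) (i : nat) : {vspace V} :=
  ((\sum_(0 <= k < i.+1) limg (Es k)) :&: (\sum_(i <= k < d.+1) limg (E k)))%VS.

Definition split_projections d (E Es P : nat -> 'End(V)) : Prop :=
  forall i, (i <= d)%N ->
    projection_onto (P i) (split_space d E Es i)
    /\ (forall j, (j <= d)%N -> j != i ->
          forall v, v \in split_space d E Es j -> P i v = 0).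

(* The split raising map for (A, theta), the split lowering map for
   (A^*, dual theta). *)
Definition split_map A d (theta : nat -> K) (P : nat -> 'End(V)) : 'End(V) :=
  A - \sum_(0 <= i < d.+1) theta i *: P i.

Definition split_transition d (Es P : nat -> 'End(V)) : 'End(V) :=
  \sum_(0 <= l < d.+1) (P l \o Es l)%VF.

(* t and ts are the eigenvalue and dual eigenvalue sequences, R and L the split
   raising and lowering maps.  Only 1 <= j <= d is meaningful.  The R L^2 term
   is absent for j = 1 and the L^2 R term is absent for j = d. *)
Definition split_H d (t ts : nat -> K) (R L : 'End(V)) (j : nat) : 'End(V) :=
  let linear_term := ((t j - t j.-1) / (ts j.-1 - ts j)) *: L in
  let RLL_term :=
    ((ts j - ts j.-1) * (ts j - ts j.-2))^-1 *: (R \o L \o L)%VF in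
  let LRL_term := ((ts j.-1 - ts j) ^+ 2)^-1 *: (L \o R \o L)%VF in
  let LLR_term :=
    ((ts j.-1 - ts j) * (ts j.-1 - ts j.+1))^-1 *: (L \o L \o R)%VF in
  if d == 1 then linear_term - LRL_term
  else if j == 1 then linear_term - LRL_term + LLR_term
  else if j == d then linear_term + RLL_term - LRL_term
  else linear_term + RLL_term - LRL_term + LLR_term.

(* The square with top f : S -> S', bottom g : U -> U' and both vertical maps
   given by restrictions of h is well defined and commutes. *)
Definition commuting_square (f g h : 'End(V)) (S S' U U' : {vspace V}) : Prop :=
  [/\ (f @: S <= S')%VS, (g @: U <= U')%VS,
      (h @: S <= U)%VS, (h @: S' <= U')%VS
    & forall v, v \in S -> h (f v) = g (h v)].

End TridiagonalSystems.

(* Main.v *)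
(** Since A - theta_i maps U_i into U_(i+1) and A* - theta*_i maps
    U_i into U_(i-1), the sum of the U_i is A- and A*-stable; it contains
    E*_0 V <> 0, so it is V by irreducibility.

    For v in E*_j V, applying F_i to A* v = theta*_j v gives
    (theta*_j - theta*_i) F_i v = calL F_(i+1) v, so F_i v = 0 for i > j, while
    F_(j-1) v, F_(j-2) v, ... are scalar multiples of calL F_j v,
    calL^2 F_j v, ...  Write A v = x + y + z with x, y, z in E*_(j-1) V, E*_j V,
    E*_(j+1) V, and compare the components F_(j+1), F_j, F_(j-1) of the two sides,
    using F_i A = theta_i F_i + calR F_(i-1): they determine in turn F_(j+1) z, F_j y
    and F_(j-1) x = T L v in terms of F_j v = T v. *)

Require Import Defs.
From mathcomp Require Import all_boot all_order all_algebra.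
From mathcomp Require Import ring zify.

Set Implicit Arguments.
Unset Strict Implicit.
Unset Printing Implicit Defensive.

Local Open Scope ring_scope.

Import GRing.Theory passmx.

(** * Sums of subspaces indexed by a sequence *)

Lemma sumv_seq_sub (K : fieldType) (V : vectType K) (I : eqType) (r : seq I)
    (W : I -> {vspace V}) (U : {vspace V}) :
  (forall k, k \in r -> (W k <= U)%VS) -> (\sum_(k <- r) W k <= U)%VS.
Proof.
move=> WU; rewrite big_seq; apply: (big_ind (fun X => X <= U)%VS) => //.
  exact: sub0v.
by move=> X Y XU YU; rewrite subv_add XU.
Qed.

Lemma sub_sumv_seq (K : fieldType) (V : vectType K) (I : eqType) (r : seq I)
    (W : I -> {vspace V}) (k : I) :
  k \in r -> (W k <= \sum_(i <- r) W i)%VS.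
Proof. by move=> kr; rewrite (big_rem k) //= addvSl. Qed.

(** * Orthogonal idempotents and resolutions of the identity *)

Section ResolutionsOfIdentity.
Variables (K : fieldType) (V : vectType K).
Implicit Types (E : nat -> 'End(V)) (d : nat).

Definition orthogonal_idempotents d E : Prop :=
  forall i j x, (i <= d)%N -> (j <= d)%N ->
    E i (E j x) = if i == j then E j x else 0.

Definition resolves_identity d E : Prop :=
  forall x, \sum_(0 <= k < d.+1) E k x = x.

Lemma sum_nat_delta d i (f : nat -> V) : (i <= d)%N ->
  \sum_(0 <= k < d.+1) (if k == i then f k else 0) = f i.
Proof. by move=> id; rewrite -big_mkcond big_nat1_eq /= ltnS id. Qed.

(** By orthogonality the operator [\sum E k - 1] kills every [limg (E i)], so its kernel contains
    their sum, which is all of V. *)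
Lemma resolves_identity_full d E : orthogonal_idempotents d E ->
  (fullv <= \sum_(0 <= k < d.+1) limg (E k))%VS -> resolves_identity d E.
Proof.
move=> orthE fullE x; apply/eqP; rewrite -subr_eq0.
suff: x \in lker (\sum_(0 <= k < d.+1) E k - \1%VF).
  by rewrite memv_ker !lfunE /= opp_lfunE id_lfunE sum_lfunE.
apply: (subvP (subv_trans fullE _)) (memvf x).
apply: sumv_seq_sub => i; rewrite mem_index_iota ltnS => /= id.
apply/subvP=> _ /memv_imgP[y _ ->].
rewrite memv_ker !lfunE /= opp_lfunE id_lfunE sum_lfunE subr_eq0.
rewrite -[eqbRHS](@sum_nat_delta d i (fun=> E i y)) //.
apply/eqP/eq_big_nat => k; rewrite ltnS => /= kd; exact: orthE.
Qed.

Lemma orthogonal_idempotents_id d E i y :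
  orthogonal_idempotents d E -> (i <= d)%N -> y \in limg (E i) -> E i y = y.
Proof. by move=> orthE id /memv_imgP[x _ ->]; rewrite orthE // eqxx. Qed.

Lemma orthogonal_idempotents_coef d E (t : nat -> K) i x :
    orthogonal_idempotents d E -> (i <= d)%N ->
  E i (\sum_(0 <= k < d.+1) t k *: E k x) = t i *: E i x.
Proof.
move=> orthE id; rewrite linear_sum /=.
rewrite -[RHS](@sum_nat_delta d i (fun=> t i *: E i x)) //.
apply: eq_big_nat => k; rewrite ltnS => /= kd; rewrite linearZ /= orthE //.
by rewrite eq_sym; case: eqP => [-> | _]; rewrite ?scaler0.
Qed.

(** Turns membership in a partial sum into vanishing of components: [E k] kills the other images,
    and conversely the expansion of [x] retains only indices in the interval. *)
Lemma mem_sum_limg d E m n x : orthogonal_idempotents d E ->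
    resolves_identity d E -> (n <= d.+1)%N ->
  x \in (\sum_(m <= k < n) limg (E k))%VS <->
  (forall k, (k <= d)%N -> ~~ (m <= k < n)%N -> E k x = 0).
Proof.
move=> orthE resE nd; split=> [xE k kd kmn | Ex0].
  apply/eqP; rewrite -memv_ker; apply: subvP xE.
  apply: sumv_seq_sub => i; rewrite mem_index_iota => imn.
  have id : (i <= d)%N by case/andP: imn => _ /leq_trans/(_ nd).
  apply/subvP=> _ /memv_imgP[y _ ->]; rewrite memv_ker orthE //.
  by case: (k =P i) => [ki | _]; rewrite ?eqxx // -ki (negPf kmn) in imn *.
rewrite -(resE x) [X in X \in _]big_nat; apply: rpred_sum => k.
rewrite ltnS => /= kd.
have [kmn | kmn] := boolP (m <= k < n)%N; last by rewrite Ex0 ?rpred0.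
have: k \in index_iota m n by rewrite mem_index_iota.
by move/(sub_sumv_seq (fun k => limg (E k)))/subvP; apply; apply/memv_img/memvf.
Qed.

(** * Primitive idempotents in a standard ordering *)

Section StandardIdempotents.
Variables (A B : 'End(V)) (d : nat) (E : nat -> 'End(V)) (t : nat -> K).
Hypothesis stdE : standard_idempotents A B d E.

Lemma standard_orthogonal : orthogonal_idempotents d E.
Proof.
case: stdE => [[[injE eigE] _] primE] i j x id jd.
have [[[_ Eid] Ekill] xj] := (primE i id, memv_img (E j) (memvf x)).
case: eqP => [ij | /eqP ij]; first by rewrite Eid // ij.
have [a a_eig Ea] := (eigE (limg (E j))).1 (ex_intro2 _ _ j jd erefl).
rewrite (Ekill a) // -Ea //; apply: contra_neq ij => /esym; exact: injE.
Qed.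

Lemma standard_resolves : lfun_diagonalizable A -> resolves_identity d E.
Proof.
case=> s sumA; apply: (resolves_identity_full standard_orthogonal).
rewrite -[X in (X <= _)%VS]sumA; apply: sumv_seq_sub => a _.
(* The list [s] may contain scalars that are not eigenvalues; these contribute the zero subspace. *)
have [-> | a_eig] := eqVneq (leigenspace A a) 0%VS; first exact: sub0v.
case: stdE => [[[_ eigE] _] _].
have [i id <-] := (eigE (leigenspace A a)).2 (ex_intro2 _ _ a a_eig erefl).
by apply: (sub_sumv_seq (fun k => limg (E k))); rewrite mem_index_iota ltnS.
Qed.

Lemma standard_neq0 i : (i <= d)%N -> limg (E i) != 0%VS.
Proof.
case: stdE => [[[_ eigE] _] _] id.
by have [a a_eig ->] := (eigE (limg (E i))).1 (ex_intro2 _ _ i id erefl).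
Qed.

Lemma standard_tridiagonal i j x : (i <= d)%N -> (j <= d)%N ->
  (i.+1 < j)%N || (j.+1 < i)%N -> E i (B (E j x)) = 0.
Proof.
have orthE := standard_orthogonal; case: stdE => [[_ tri] _] id jd ij.
apply/eqP; rewrite -memv_ker.
apply: (subvP (subv_trans (tri j jd) _)); last exact/memv_img/memv_img/memvf.
have kill k : (k <= d)%N -> i != k -> (limg (E k) <= lker (E i))%VS.
  move=> kd ik; apply/subvP=> _ /memv_imgP[y _ ->].
  by rewrite memv_ker orthE // (negPf ik).
rewrite /neighbour_sum !subv_add kill //; last lia.
apply/andP; split; case: ifP => // ?; rewrite ?sub0v // kill //; lia.
Qed.

Hypothesis eig : eigenvalue_sequence A d E t.

Lemma standard_eigen_left i x : (i <= d)%N -> A (E i x) = t i *: E i x.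
Proof.
move=> id; have := memv_img (E i) (memvf x).
rewrite (eig id).2 memv_ker add_lfunE opp_lfunE scale_lfunE id_lfunE subr_eq0.
by move/eqP.
Qed.

(** Expanding [x] into eigencomponents makes [A] act diagonally, and [E i] picks out the i-th
    coefficient. *)
Lemma standard_eigen_right i x : lfun_diagonalizable A -> (i <= d)%N ->
  E i (A x) = t i *: E i x.
Proof.
move=> diagA id.
rewrite -(orthogonal_idempotents_coef t x standard_orthogonal id).
rewrite -[x in LHS](standard_resolves diagA) linear_sum /=; congr (E i _).
by apply: eq_big_nat => k; rewrite ltnS => /= kd; rewrite standard_eigen_left.
Qed.

Lemma standard_eigenvalues_inj i k : (i <= d)%N -> (k <= d)%N ->
  t i = t k -> i = k.
Proof.
case: stdE => [[[injE _] _] _] id kd tik; apply: injE => //.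
by rewrite (eig id).2 (eig kd).2 tik.
Qed.

End StandardIdempotents.
End ResolutionsOfIdentity.

(** * The split decomposition of V *)

Section SplitDecomposition.
Variables (K : fieldType) (V : vectType K) (d : nat) (A As : 'End(V)).
Variables (E Es F : nat -> 'End(V)) (theta thetas : nat -> K).
Hypothesis Phi : tridiagonal_system A d E As Es.
Hypothesis theta_eig : eigenvalue_sequence A d E theta.
Hypothesis thetas_eig : eigenvalue_sequence As d Es thetas.

Let stdE : standard_idempotents A As d E. Proof. by case: Phi. Qed.
Let stdEs : standard_idempotents As A d Es. Proof. by case: Phi. Qed.
Let diagA : lfun_diagonalizable A. Proof. by case: Phi => [[[]]]. Qed.
Let diagAs : lfun_diagonalizable As. Proof. by case: Phi => [[[]]]. Qed.
Let orthE := standard_orthogonal stdE.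
Let orthEs := standard_orthogonal stdEs.
Let resE := standard_resolves stdE diagA.
Let resEs := standard_resolves stdEs diagAs.
Local Notation U := (split_space d E Es).

Lemma mem_split_space i x : (i <= d)%N ->
  x \in U i <->
  (forall k, (k <= d)%N ->
     ((i < k)%N -> Es k x = 0) /\ ((k < i)%N -> E k x = 0)).
Proof.
move=> id; rewrite /split_space memv_cap.
have memEs := @mem_sum_limg K V d Es 0 i.+1 x orthEs resEs id.
have memE := @mem_sum_limg K V d E i d.+1 x orthE resE (leqnn _).
split=> [/andP[/memEs xEs /memE xE] k kd | xU].
  by split=> ki; [apply: xEs | apply: xE] => //; lia.
by apply/andP; split; [apply/memEs | apply/memE] => k kd ?; apply xU => //; lia.
Qed.

(** [E k] multiplies by theta_k - theta_i on [E k x], which gives 0 for all k <= i. On the dual side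
    [A] moves each E*_l V by at most one step, so no component beyond i+1 appears. *)
Lemma split_space_raise i x : (i <= d)%N -> x \in U i ->
  A x - theta i *: x \in (if (i < d)%N then U i.+1 else 0%VS).
Proof.
move=> id /(mem_split_space _ id) xU.
have killE k : (k <= d)%N -> (k <= i)%N -> E k (A x - theta i *: x) = 0.
  move=> kd; rewrite linearB linearZ /=.
  rewrite (standard_eigen_right stdE theta_eig) //.
  rewrite leq_eqVlt => /predU1P[-> | ki]; first by rewrite subrr.
  by rewrite (xU k kd).2 // !scaler0 subrr.
case: ifP => [i_lt_d | i_ge_d].
  apply/(mem_split_space _ i_lt_d) => k kd; split=> ki; last exact: killE.
  rewrite linearB linearZ /= (xU k kd).1 ?(ltnW ki) // scaler0 subr0.
  rewrite -(resEs x) !linear_sum big_nat big1 // => l; rewrite ltnS => /= ld.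
  have [li | il] := leqP l i.
    by rewrite (standard_tridiagonal stdEs) //; lia.
  by rewrite (xU l ld).1 // !linear0.
(* Here i = d, so all [E]-components vanish and the vector is 0. *)
rewrite memv0 -(resE (A x - _)) big_nat big1 // => k; rewrite ltnS => /= kd.
by apply: killE; lia.
Qed.

(** The mirror argument: the eigenvalue factor removes the [Es]-components from i upwards, and
    tridiagonality of [As] on the [E] side allows a descent of one step only. *)
Lemma split_space_lower i x : (i <= d)%N -> x \in U i ->
  As x - thetas i *: x \in (if (0 < i)%N then U i.-1 else 0%VS).
Proof.
move=> id /(mem_split_space _ id) xU.
have killEs k : (k <= d)%N -> (i <= k)%N -> Es k (As x - thetas i *: x) = 0.
  move=> kd; rewrite linearB linearZ /=.
  rewrite (standard_eigen_right stdEs thetas_eig) //.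
  rewrite leq_eqVlt => /predU1P[-> | ki]; first by rewrite subrr.
  by rewrite (xU k kd).1 // !scaler0 subrr.
case: ifP => [i_gt0 | i_le0].
  have id' : (i.-1 <= d)%N by lia.
  apply/(mem_split_space _ id') => k kd.
  split=> ki; first by apply: killEs; lia.
  rewrite linearB linearZ /= (xU k kd).2; last lia.
  rewrite scaler0 subr0 -(resE x) !linear_sum big_nat big1 // => l.
  rewrite ltnS => /= ld; have [il | li] := leqP i l.
    by rewrite (standard_tridiagonal stdE) //; lia.
  by rewrite (xU l ld).2 // !linear0.
rewrite memv0 -(resEs (As x - _)) big_nat big1 // => k; rewrite ltnS => /= kd.
by apply: killEs; lia.
Qed.

Lemma split_spaces_full : (\sum_(0 <= i < d.+1) U i)%VS = fullv.
Proof.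
set W := (\sum_(0 <= i < d.+1) U i)%VS.
have UW i : (i <= d)%N -> (U i <= W)%VS.
  by move=> id; apply: (sub_sumv_seq U); rewrite mem_index_iota ltnS.
(* Covers [A] and [As] together, by writing X x as (X x - t_i x) + t_i x on each U_i. *)
have stable (X : 'End(V)) (t : nat -> K) (f : nat -> {vspace V}) :
    (forall i, (i <= d)%N -> (f i <= W)%VS) ->
    (forall i x, (i <= d)%N -> x \in U i -> X x - t i *: x \in f i) ->
  (X @: W <= W)%VS.
  move=> fW Xf; rewrite limg_sum; apply: sumv_seq_sub => i.
  rewrite mem_index_iota ltnS => /= id; apply/subvP=> _ /memv_imgP[x xU ->].
  rewrite -(subrK (t i *: x) (X x)) rpredD ?rpredZ //.
    exact: subvP (fW i id) _ (Xf i x id xU).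
  exact: subvP (UW i id) _ xU.
have AW : (A @: W <= W)%VS.
  apply: stable split_space_raise => i _.
  by case: ifP => ?; rewrite ?sub0v ?UW.
have AsW : (As @: W <= W)%VS.
  apply: stable split_space_lower => i id.
  by case: ifP => ?; rewrite ?sub0v ?UW //; lia.
have W_neq0 : W != 0%VS.
  apply: contraNneq (standard_neq0 stdEs (leq0n d)) => W0.
  rewrite -subv0 -W0; apply: subv_trans (UW 0%N (leq0n d)).
  apply/subvP=> _ /memv_imgP[x _ ->]; apply/mem_split_space => // k kd.
  by split=> // k_gt0; rewrite orthEs // gtn_eqF.
case: Phi => [[_ _ _ irr] _ _]; apply/eqP/negPn/negP => W_neqT.
by apply: irr; exists W.
Qed.

(** * Split projections with the split raising and lowering maps *)

Hypothesis F_proj : split_projections d E Es F.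
Local Notation R := (split_map A d theta F).
Local Notation L := (split_map As d thetas F).

Lemma limg_split_projection i : (i <= d)%N -> limg (F i) = U i.
Proof. by move=> id; case: (F_proj id) => [[]]. Qed.

Lemma split_projections_orthogonal : orthogonal_idempotents d F.
Proof.
move=> i j x id jd; have [[_ Fid] Fkill] := F_proj id.
have xj : F j x \in U j by rewrite -limg_split_projection // memv_img ?memvf.
case: eqP => [ij | /eqP ij]; first by rewrite Fid // ij.
by rewrite (Fkill j) // eq_sym.
Qed.
Let orthF := split_projections_orthogonal.

Lemma split_projections_resolve : resolves_identity d F.
Proof.
apply: (resolves_identity_full orthF).
rewrite -[X in (X <= _)%VS]split_spaces_full; apply: sumv_seq_sub => i id.
move: (id); rewrite mem_index_iota ltnS => /= /limg_split_projection <-.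
exact: (sub_sumv_seq (fun k => limg (F k))).
Qed.
Let resF := split_projections_resolve.

(** On U_i only the i-th term of the subtracted sum survives; this lets the facts on X - t_i over
    U_i apply to the split maps. *)
Lemma split_mapE X (t : nat -> K) i x : (i <= d)%N ->
  split_map X d t F (F i x) = X (F i x) - t i *: F i x.
Proof.
move=> id; rewrite add_lfunE opp_lfunE sum_lfunE; congr (_ - _).
rewrite -[RHS](@sum_nat_delta _ _ d i (fun=> t i *: F i x)) //.
apply: eq_big_nat => k; rewrite ltnS => /= kd; rewrite scale_lfunE orthF //.
by case: eqP => [-> | _]; rewrite ?scaler0.
Qed.

Lemma split_map_decomposition (X : 'End(V)) (t : nat -> K) x :
  X x = \sum_(0 <= k < d.+1) t k *: F k x + split_map X d t F x.
Proof.
rewrite add_lfunE opp_lfunE sum_lfunE addrC.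
by under eq_bigr do rewrite scale_lfunE; rewrite subrK.
Qed.

Lemma split_raising_mem i x : (i < d)%N -> x \in limg (F i) ->
  R x \in limg (F i.+1).
Proof.
move=> id /memv_imgP[y _ ->]; have id' := ltnW id; rewrite split_mapE //.
rewrite limg_split_projection //.
have := @split_space_raise i (F i y) id'; rewrite id; apply.
by rewrite -limg_split_projection // memv_img ?memvf.
Qed.

Lemma split_raising_top x : R (F d x) = 0.
Proof.
apply/eqP; rewrite -memv0 split_mapE //.
have := @split_space_raise d (F d x) (leqnn d); rewrite ltnn; apply.
by rewrite -limg_split_projection // memv_img ?memvf.
Qed.

Lemma split_lowering_mem i x : (i < d)%N -> x \in limg (F i.+1) ->
  L x \in limg (F i).
Proof.
move=> id /memv_imgP[y _ ->]; have id' := ltnW id; rewrite split_mapE //.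
rewrite limg_split_projection //; apply: (@split_space_lower i.+1) => //.
by rewrite -limg_split_projection // memv_img ?memvf.
Qed.

Lemma split_lowering_bottom x : L (F 0%N x) = 0.
Proof.
apply/eqP; rewrite -memv0 split_mapE //; apply: (@split_space_lower 0%N) => //.
by rewrite -limg_split_projection // memv_img ?memvf.
Qed.

(** [A] is its diagonal part plus [R], and among the vectors [R (F k x)] only the one with k = i-1
    has a component in U_i. *)
Lemma split_projection_raise i x : (i <= d)%N ->
  F i (A x) = theta i *: F i x + (if (0 < i)%N then R (F i.-1 x) else 0).
Proof.
move=> id.
rewrite (split_map_decomposition A theta) linearD /=.
rewrite orthogonal_idempotents_coef //; congr (_ + _).
rewrite -{1}(resF x) !linear_sum /=.
transitivity (\sum_(0 <= k < d.+1) (if k.+1 == i then R (F k x) else 0)).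
  apply: eq_big_nat => k; rewrite ltnS => /=.
  rewrite leq_eqVlt => /predU1P[-> | kd].
    by rewrite split_raising_top linear0 if_same.
  have /memv_imgP[y _ ->] := split_raising_mem kd (memv_img (F k) (memvf x)).
  by rewrite orthF // eq_sym.
case: i id => [|i] id /=; first by rewrite big1.
by apply: (@sum_nat_delta _ _ d i (fun k => R (F k x))); apply: ltnW.
Qed.

Lemma split_projection_lower i x : (i <= d)%N ->
  F i (As x) = thetas i *: F i x + (if (i < d)%N then L (F i.+1 x) else 0).
Proof.
move=> id.
rewrite (split_map_decomposition As thetas) linearD /=.
rewrite orthogonal_idempotents_coef //; congr (_ + _).
(* The term of index 0 vanishes because [L] kills U_0; splitting it off lets the remaining indices
   be written k+1. *)
rewrite -{1}(resF x) !linear_sum /= big_nat_recl // split_lowering_bottom.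
rewrite linear0 add0r.
transitivity (\sum_(0 <= k < d) (if k == i then L (F k.+1 x) else 0)).
  apply: eq_big_nat => k /= kd.
  have /memv_imgP[y _ ->] :=
    split_lowering_mem kd (memv_img (F k.+1) (memvf x)).
  by rewrite orthF // 1?ltnW // eq_sym.
by rewrite -big_mkcond big_nat1_eq.
Qed.

(** * Split components of a dual eigenvector *)

Section DualEigenvector.
Variables (j : nat) (v : V).
Hypotheses (jd : (j <= d)%N) (v_Esj : v \in limg (Es j)).

Lemma split_component_eq i : (i <= d)%N ->
  (thetas j - thetas i) *: F i v = if (i < d)%N then L (F i.+1 v) else 0.
Proof.
move=> id; have Asv : As v = thetas j *: v.
  by rewrite -(orthogonal_idempotents_id orthEs jd v_Esj)
    (standard_eigen_left thetas_eig).
have := split_projection_lower v id; rewrite Asv linearZ /= => /eqP.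
by rewrite addrC -subr_eq -scalerBl => /eqP.
Qed.

Lemma dual_eigenvalue_neq i : (i <= d)%N -> i != j -> thetas j - thetas i != 0.
Proof.
move=> id; apply: contra_neq => /eqP; rewrite subr_eq0 => /eqP ji.
exact/esym/(standard_eigenvalues_inj stdEs thetas_eig).
Qed.

Lemma split_component_above i : (j < i)%N -> (i <= d)%N -> F i v = 0.
Proof.
(* Descending induction on i, run on a bound for d - i: at i = d the right side of
   [split_component_eq] is 0, and below it is [L] of a component already known to vanish. *)
move: {2}(d - i)%N (leqnn (d - i)) => n; elim: n i => [|n IHn] i din ji id.
all: have ij : thetas j - thetas i != 0 by rewrite dual_eigenvalue_neq ?gtn_eqF.
all: apply/eqP; rewrite -[_ == 0]orFb -(negPf ij) -scaler_eq0.
all: rewrite split_component_eq //; case: ifP => // id'.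
  lia.
by rewrite IHn ?linear0 //; lia.
Qed.

Lemma split_component_below i : (i < j)%N ->
  F i v = (thetas j - thetas i)^-1 *: L (F i.+1 v).
Proof.
move=> ij; have id : (i < d)%N by lia.
have := split_component_eq (ltnW id); rewrite id => <-.
by rewrite scalerA mulVf ?scale1r // dual_eigenvalue_neq ?ltn_eqF // ltnW.
Qed.

End DualEigenvector.

(** * The maps H_j, T and L on vectors *)

(** The four cases of the definition differ only in whether two terms are present: R L^2 exactly
    when 1 < j, and L^2 R exactly when j < d. *)
Lemma split_H_apply j w : (1 <= j <= d)%N ->
  split_H d theta thetas R L j w =
    ((theta j - theta j.-1) / (thetas j.-1 - thetas j)) *: L w
    + (if (1 < j)%N then
         ((thetas j - thetas j.-1) * (thetas j - thetas j.-2))^-1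
           *: R (L (L w)) else 0)
    - ((thetas j.-1 - thetas j) ^+ 2)^-1 *: L (R (L w))
    + (if (j < d)%N then
         ((thetas j.-1 - thetas j) * (thetas j.-1 - thetas j.+1))^-1
           *: L (L (R w)) else 0).
Proof.
move=> /andP[j_ge1 jd]; rewrite /split_H.
have lfE := (add_lfunE, opp_lfunE, scale_lfunE, comp_lfunE).
case: (d =P 1%N) => [d1 | d_neq1].
  by rewrite !ifF ?lfE ?addr0 //; lia.
case: (j =P 1%N) => [-> | j_neq1].
  by rewrite ifT ?lfE ?addr0 //; lia.
case: (j =P d) => [-> | j_neqd].
  by rewrite ltnn ifT ?lfE ?addr0 //; lia.
by rewrite !ifT ?lfE //; lia.
Qed.

Lemma split_H_mem j w : (1 <= j <= d)%N -> w \in limg (F j) ->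
  split_H d theta thetas R L j w \in limg (F j.-1).
Proof.
case: j => [//|j] /andP[_ jd] wFj; rewrite split_H_apply //=.
have LwFj : L w \in limg (F j) by apply: split_lowering_mem.
rewrite rpredD ?rpredB ?rpredD ?rpredZ //.
- case: j jd wFj LwFj => [|j] jd wFj LwFj; first by rewrite rpred0.
  by rewrite rpredZ // split_raising_mem ?split_lowering_mem // ltnW.
- by rewrite split_lowering_mem ?split_raising_mem.
- case: ifP => [j_lt_d|_]; last by rewrite rpred0.
  by rewrite rpredZ // !split_lowering_mem ?split_raising_mem.
Qed.

Lemma split_transition_apply j v : (j <= d)%N -> v \in limg (Es j) ->
  split_transition d Es F v = F j v.
Proof.
move=> jd /memv_imgP[x _ ->]; rewrite sum_lfunE.
rewrite -[RHS](@sum_nat_delta _ _ d j (fun=> F j (Es j x))) //.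
apply: eq_big_nat => k; rewrite ltnS => /= kd; rewrite comp_lfunE orthEs //.
by case: eqP => [-> | _]; rewrite ?linear0.
Qed.

Lemma lowering_map_apply j v : (1 <= j <= d)%N -> v \in limg (Es j) ->
  lowering_map A d Es v = Es j.-1 (A v).
Proof.
move=> /andP[j_ge1 jd] /memv_imgP[x _ ->]; rewrite sum_lfunE.
transitivity (\sum_(1 <= k < d.+1) if k == j then Es k.-1 (A (Es k x)) else 0).
  apply: eq_big_nat => k /andP[_]; rewrite ltnS => kd.
  by rewrite !comp_lfunE orthEs //; case: eqP => [-> | _]; rewrite ?linear0.
by rewrite -big_mkcond big_nat1_eq j_ge1 ltnS jd.
Qed.

Lemma split_projection_lowering j v : (1 <= j <= d)%N -> v \in limg (Es j) ->
  F j.-1 (Es j.-1 (A v)) = split_H d theta thetas R L j (F j v).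
Proof.
(* From here [j] stands for the former index minus one: [v] lies in E*_(j+1) V, and the parts x, y,
   z of A v lie in E*_j V, E*_(j+1) V, E*_(j+2) V, with z = 0 when j+1 = d. *)
case: j => [//|j] jd vEs; have {}jd : (j < d)%N by [].
rewrite split_H_apply //=; have jd' := ltnW jd.
have sj : thetas j.+1 - thetas j != 0.
  by rewrite (dual_eigenvalue_neq jd) // ltn_eqF.
have /memv_addP[xy /memv_addP[x xEs [y yEs ->]] [z zEs Av]] :
    A v \in neighbour_sum d (fun i => limg (Es i)) j.+1.
  by case: stdEs => [[_ tri] _]; apply: subvP (tri _ jd) _ (memv_img _ vEs).
rewrite /= in xEs zEs.
have Es_kill i k u : (i <= d)%N -> (k <= d)%N -> i != k ->
    u \in limg (Es k) -> Es i u = 0.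
  by move=> id kd ik /memv_imgP[u' _ ->]; rewrite orthEs // (negPf ik).
have -> : Es j (A v) = x.
  rewrite Av !linearD /= (orthogonal_idempotents_id orthEs jd' xEs).
  rewrite (Es_kill _ _ _ jd' jd _ yEs) ?ltn_eqF // addr0.
  move: zEs; case: ifP => [jd2 | _]; last first.
    by rewrite memv0 => /eqP ->; rewrite linear0 addr0.
  by move=> /(Es_kill j) -> //; rewrite ?addr0 // ltn_eqF.
set w := F j.+1 v.
have Fjv : F j v = (thetas j.+1 - thetas j)^-1 *: L w.
  exact: split_component_below vEs _ _.
(* The target is now F_j x; the remaining work expresses each term on the right through [w]. *)
have Fjx : F j x = F j (A v) - F j y - F j z.
  by rewrite Av !linearD /= addrAC !addrK.
have Fj1x : F j.+1 x = 0 by apply: split_component_above jd' xEs _ _ _.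
have Fjy : F j y = (thetas j.+1 - thetas j)^-1 *: L (F j.+1 y).
  exact: split_component_below yEs _ _.
have Fj1y : F j.+1 y = F j.+1 (A v) - F j.+1 z.
  by rewrite Av !linearD /= Fj1x add0r addrK.
have FjA : F j (A v) = theta j *: F j v + (if (0 < j)%N then
    (thetas j.+1 - thetas j.-1)^-1 *: R (L (F j v)) else 0).
  rewrite split_projection_raise //; congr (_ + _); case: ifP => // j_gt0.
  (* The component F_(j-1) v is a multiple of L F_j v; this is the source of the R L^2 term. *)
  rewrite (split_component_below jd vEs (i := j.-1)); last lia.
  by rewrite linearZ prednK.
have Fj1A : F j.+1 (A v) = theta j.+1 *: w + R (F j v).
  by rewrite split_projection_raise.
have [Fj1z Fjz] :
    F j.+1 z = (if (j.+1 < d)%N then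
      (thetas j.+2 - thetas j.+1)^-1 *: L (R w) else 0)
    /\ F j z = (if (j.+1 < d)%N then
      (thetas j.+2 - thetas j)^-1 *: L (F j.+1 z) else 0).
  move: zEs; case: ifP => [jd2 zEs | _]; last first.
    by rewrite memv0 => /eqP ->; rewrite !linear0.
  (* At index j+2 the vectors v, x, y have no component, so the raised vector [R w] comes from z
     alone. *)
  suff Fj2z : F j.+2 z = R w.
    by rewrite -Fj2z; split; apply: split_component_below jd2 zEs _ _; lia.
  have := split_projection_raise v jd2.
  rewrite (split_component_above jd vEs) // scaler0 add0r /= => <-.
  rewrite Av !linearD /= (split_component_above jd' xEs) //.
  by rewrite (split_component_above jd yEs) // !add0r.
(* [al] is the scalar common to F_j v and F_j y, since v and y lie in the same E*_(j+1) V. *)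
pose al := (thetas j.+1 - thetas j)^-1; rewrite -/al in Fjv Fjy.
have sj' : thetas j - thetas j.+1 != 0 by rewrite -opprB oppr_eq0.
(* The coefficient of [L w]: theta_j * al comes from F_j A v, and al * theta_(j+1) from F_j y. *)
have eq_linear : (theta j.+1 - theta j) / (thetas j - thetas j.+1)
    = theta j * al - al * theta j.+1.
  by rewrite /al; field; rewrite sj sj'.
have eq_LRL : (thetas j - thetas j.+1) ^- 2 = al * al.
  by rewrite /al -expr2 exprVn -opprB sqrrN.
have eq_RLL : (if (0 < j)%N then
      (thetas j.+1 - thetas j.-1)^-1 *: R (L (F j v)) else 0)
    = (if (1 < j.+1)%N then
      ((thetas j.+1 - thetas j) * (thetas j.+1 - thetas j.-1))^-1
        *: R (L (L w)) else 0).
  rewrite ltnS Fjv; case: ifP => // _.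
  by rewrite !linearZ /= scalerA -invfM mulrC.
(* z enters twice, through F_j y and directly. The difference al - 1/(theta*_(j+2) - theta*_j) has
   numerator theta*_(j+2) - theta*_(j+1), cancelling the denominator of F_(j+1) z. *)
have eq_LLR : al *: L (F j.+1 z) - F j z = (if (j.+1 < d)%N then
    ((thetas j - thetas j.+1) * (thetas j - thetas j.+2))^-1
      *: L (L (R w)) else 0).
  rewrite Fjz Fj1z; case: ifP => [jd2 | _]; last first.
    by rewrite linear0 scaler0 subr0.
  have s2 i : (i < j.+2)%N -> thetas j.+2 - thetas i != 0.
    by move=> ij; rewrite (dual_eigenvalue_neq jd2) ?ltn_eqF //; lia.
  have s2' : thetas j - thetas j.+2 != 0 by rewrite -opprB oppr_eq0 s2.
  rewrite linearZ /= !scalerA -scalerBl; congr (_ *: _); rewrite /al.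
  by field; rewrite sj sj' s2' !s2.
rewrite -eq_RLL -eq_LLR eq_LRL eq_linear Fjx FjA Fjy Fj1y Fj1A Fjv.
set q := (if (0 < j)%N then _ else _).
rewrite (linearB L) (linearD L) !linearZ /=.
rewrite !scalerN scalerBr scalerDr !scalerA scalerBl.
rewrite opprB opprD (mulrC (theta j)) !addrA.
by congr (_ - _); rewrite [LHS](ACl (1*4*2*5*3))%AC.
Qed.

End SplitDecomposition.

(** * The commuting square *)

Theorem theorem8p11 (K : fieldType) (V : vectType K)
  (V_neq0 : (fullv : {vspace V}) != 0%VS)
  (d : nat) (d_ge1 : (1 <= d)%N)
  (A As : 'End(V)) (E Es : nat -> 'End(V))
  (Phi : tridiagonal_system A d E As Es)
  (theta thetas : nat -> K)
  (theta_eig : eigenvalue_sequence A d E theta)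
  (thetas_eig : eigenvalue_sequence As d Es thetas)
  (F : nat -> 'End(V)) (F_proj : split_projections d E Es F)
  (j : nat) (j_ge1 : (1 <= j)%N) (j_le_d : (j <= d)%N) :
  let L := lowering_map A d Es in
  let calR := split_map A d theta F in
  let calL := split_map As d thetas F in
  let T := split_transition d Es F in
  let H := split_H d theta thetas calR calL in
  commuting_square L (H j) T
    (limg (Es j)) (limg (Es j.-1)) (limg (F j)) (limg (F j.-1)).
Proof.
move=> L calR calL T H; have j_bounds : (1 <= j <= d)%N by rewrite j_ge1.
have jd' : (j.-1 <= d)%N by rewrite (leq_trans (leq_pred j)).
have Lv v : v \in limg (Es j) -> L v = Es j.-1 (A v).
  exact: (lowering_map_apply Phi).
have T_apply i v : (i <= d)%N -> v \in limg (Es i) -> T v = F i v.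
exact: (split_transition_apply F Phi).
split.
- apply/subvP=> _ /memv_imgP[v vEs ->].
  by rewrite Lv // memv_img ?memvf.
- apply/subvP=> _ /memv_imgP[w wF ->].
  exact: (split_H_mem Phi theta_eig thetas_eig F_proj).
- apply/subvP=> _ /memv_imgP[v vEs ->].
  by rewrite (T_apply j) // memv_img ?memvf.
- apply/subvP=> _ /memv_imgP[v vEs ->].
  by rewrite (T_apply j.-1) // memv_img ?memvf.
- move=> v vEs; rewrite (T_apply j v) // Lv //.
  rewrite (T_apply j.-1) ?memv_img ?memvf //.
  exact: (split_projection_lowering Phi theta_eig thetas_eig F_proj).
Qed.
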